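(* Welded equivalence does not imply rotational welded equivalence: there are virtual 1-knot diagrams which are welded equivalent but not rotational welded equivalent.
   Context: A virtual 1-knot diagram is a generic immersed oriented circle in $\mathbb R^2$ whose transverse double points are each marked as a classical crossing (with over/under information) or a virtual crossing. Welded equivalence: the equivalence relation on virtual 1-knot diagrams generated by planar isotopy, the classical Reidemeister moves I, II, III, the virtual Reidemeister moves I, II, III (same moves with all crossings virtual), the mixed move (an arc with only virtual crossings is moved past a classical crossing), and the welded move (an arc lying over both strands of a virtual crossing is moved across that virtual crossing). Rotational welded equivalence: the same, but with the virtual Reidemeister move I forbidden. *)

(* Defs.v *)
From HB Require Import structures.
From mathcomp Require Import all_boot all_order all_algebra.
From mathcomp Require Import all_classical all_reals all_analysis.
From Stdlib Require Import Relation_Operators.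

Set Implicit Arguments.
Unset Strict Implicit.
Unset Printing Implicit Defensive.

Import Order.TTheory GRing.Theory Num.Theory.
Import numFieldNormedType.Exports.

Local Open Scope classical_set_scope.
Local Open Scope ring_scope.

(** * Differentiability

    Diagrams and isotopies are taken in the C^1 category.  This gives the same
    equivalence classes as C^oo, and lets the two sides of each move below be
    polynomial arcs that agree to first order on the boundary of a box. *)

Definition C1 (R : realType) (V W : normedModType R) (f : V -> W) : Prop :=
  (forall x, differentiable f x) /\
  (forall v, continuous (fun x => 'd f x v)).

Definition diffeo (R : realType) (f : R * R -> R * R) : Prop :=
  C1 f /\ exists g : R * R -> R * R, [/\ C1 g, cancel f g & cancel g f].

(** * Virtual 1-knot diagrams *)

(* The circle is R/Z, and a closed curve is a 1-periodic map on R. *)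
Definition same_param (R : realType) (s t : R) : Prop := s - t \is a Num.int.

Definition double_pair (R : realType) (f : R -> R * R) (s t : R) : Prop :=
  f s = f t /\ ~ same_param s t.

Definition det2 (R : realType) (u v : R * R) : R := u.1 * v.2 - u.2 * v.1.

(* The finiteness clause follows from the others by compactness of the circle;
   it is listed because it is part of the usual meaning of "generic". *)
Record generic_immersion (R : realType) (f : R -> R * R) : Prop := {
  gi_periodic : forall s, f (s + 1) = f s;
  gi_C1 : C1 f;
  gi_immersed : forall s, derive1 f s <> 0;
  gi_transverse : forall s t, double_pair f s t ->
    det2 (derive1 f s) (derive1 f t) <> 0;
  gi_no_triple : forall s t u,
    double_pair f s t -> double_pair f t u -> same_param s u;
  gi_finite : finite_set [set p | exists s t, double_pair f s t /\ f s = p]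
}.

Inductive mark := Over | Under | Virtual.

Definition flip (m : mark) : mark :=
  match m with Over => Under | Under => Over | Virtual => Virtual end.

(* [crossing D s t] is meaningful only when [s] and [t] are the two preimages
   of a double point; [Over] then says that the strand at [s] passes over the
   strand at [t].  The orientation is that of increasing parameter. *)
Record diagram (R : realType) := Diagram {
  curve : R -> R * R;
  crossing : R -> R -> mark;
  curve_generic : generic_immersion curve;
  crossing_flip : forall s t, double_pair curve s t ->
    crossing t s = flip (crossing s t);
  crossing_periodic : forall s t, double_pair curve s t ->
    crossing (s + 1) t = crossing s t
}.

(** * Planar isotopy *)

(* Orientation-preserving reparametrization of the circle, lifted to R. *)
Definition reparam (R : realType) (h : R -> R) : Prop :=
  [/\ C1 h, forall s, 0 < derive1 h s & forall s, h (s + 1) = h s + 1].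

Definition ambient_isotopy (R : realType) (H : R -> R * R -> R * R) : Prop :=
  [/\ C1 (fun x : R * (R * R) => H x.1 x.2),
      forall t : R, 0 <= t <= 1 -> diffeo (H t)
    & forall p, H 0 p = p].

Definition planar_isotopic (R : realType) (D D' : diagram R) : Prop :=
  exists (H : R -> R * R -> R * R) (h : R -> R),
    [/\ ambient_isotopy H, reparam h,
        forall s, curve D' (h s) = H 1 (curve D s)
      & forall s t, double_pair (curve D) s t ->
          crossing D' (h s) (h t) = crossing D s t].

(** * Local moves *)

(* A tangle with [n] strands in [box]; strand [i] is [strand T i] restricted to
   [-1, 1].  [tmark T i s j t] marks the crossing of strand [i] at parameter [s]
   with strand [j] at parameter [t], and is irrelevant elsewhere. *)
Record tangle (R : realType) (n : nat) := Tangle {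
  strand : 'I_n -> R -> R * R;
  tmark : 'I_n -> R -> 'I_n -> R -> mark
}.

Definition box (R : realType) : set (R * R) :=
  [set p | (-1 <= p.1 <= 1) && (-2 <= p.2 <= 2)].

(* Strand [i] occupies the parameters [c i + r i * t] with -1 <= t <= 1; the
   strand is traversed backwards when [r i < 0]. *)
Definition strand_param (R : realType) (n : nat) (c r : 'I_n -> R) (s : R) :
    Prop :=
  exists (i : 'I_n) (t : R), -1 <= t <= 1 /\ same_param s (c i + r i * t).

Definition disjoint_strands (R : realType) (n : nat) (c r : 'I_n -> R) : Prop :=
  (forall i, r i != 0) /\
  (forall (i j : 'I_n) (s t : R), -1 <= s <= 1 -> -1 <= t <= 1 ->
     same_param (c i + r i * s) (c j + r j * t) -> i = j /\ s = t).

(* The part of [D] lying in the disc [e @` box] is the image of [T] by [e]. *)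
Definition contains (R : realType) (n : nat) (e : R * R -> R * R)
    (c r : 'I_n -> R) (T : tangle R n) (D : diagram R) : Prop :=
  [/\ forall (i : 'I_n) (t : R), -1 <= t <= 1 -> curve D (c i + r i * t) = e (strand T i t),
      forall s, (e @` @box R) (curve D s) -> strand_param c r s
    & forall (i j : 'I_n) (s t : R), -1 <= s <= 1 -> -1 <= t <= 1 ->
        double_pair (curve D) (c i + r i * s) (c j + r j * t) ->
        crossing D (c i + r i * s) (c j + r j * t) = tmark T i s j t].

(* [e] may reverse the orientation of the plane, so that each model below also
   stands for its mirror image in a line of the plane (which leaves over and
   under unchanged). *)
Definition local_move (R : realType) (n : nat) (T T' : tangle R n)
    (D D' : diagram R) : Prop :=
  exists (e : R * R -> R * R) (c r : 'I_n -> R),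
    [/\ diffeo e /\ disjoint_strands c r,
        contains e c r T D,
        contains e c r T' D',
        forall s, ~ strand_param c r s -> curve D s = curve D' s
      & forall s t, ~ strand_param c r s -> ~ strand_param c r t ->
          double_pair (curve D) s t -> crossing D s t = crossing D' s t].

(* Reidemeister I.  The curl has its single crossing on the axis x = 0, at
   opposite parameters; [m] is the mark of the passage at the smaller one. *)
Definition tangle1_flat (R : realType) : tangle R 1 :=
  Tangle (fun _ t => (t, 0)) (fun _ _ _ _ => Virtual).

Definition tangle1_curl (R : realType) (m : mark) : tangle R 1 :=
  Tangle (fun _ t => (- t + 4 * t ^+ 3 - 2 * t ^+ 5, (1 - t ^+ 2) ^+ 2))
         (fun _ s _ t => if s < t then m else flip m).

Definition move1 (R : realType) (m : mark) : diagram R -> diagram R -> Prop :=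
  local_move (tangle1_flat R) (tangle1_curl R m).

(* Reidemeister II.  Strand 1 is pushed across strand 0, creating two crossings
   at both of which strand 0 has mark [m]. *)
Definition mark2 (m : mark) (i j : 'I_2) : mark :=
  if (i < j)%N then m else flip m.

Definition tangle2_apart (R : realType) : tangle R 2 :=
  Tangle (fun i t => if val i == 0%N then (t, 0) else (t, 1))
         (fun _ _ _ _ => Virtual).

Definition tangle2_crossed (R : realType) (m : mark) : tangle R 2 :=
  Tangle (fun i t => if val i == 0%N then (t, 0)
                     else (t, 1 - 2 * (1 - t ^+ 2) ^+ 2))
         (fun i _ j _ => mark2 m i j).

Definition move2 (R : realType) (m : mark) : diagram R -> diagram R -> Prop :=
  local_move (tangle2_apart R) (tangle2_crossed R m).

(* Triangle moves.  Strand 2 is pushed, from above ([a = 1]) to below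
   ([a = -1]), across the crossing of the strands 0 and 1 at the origin.  Each
   pair of strands crosses exactly once on either side of the move, and
   [m i j] is the mark of strand [i] at its crossing with strand [j]. *)
Definition tangle3 (R : realType) (a : R) (m : 'I_3 -> 'I_3 -> mark) :
    tangle R 3 :=
  Tangle (fun i t => match val i with
                     | 0%N => (t, t)
                     | 1%N => (t, - t)
                     | _ => (t, a * (1 - t ^+ 2) ^+ 2 / 2)
                     end)
         (fun i _ j _ => m i j).

Definition move3 (R : realType) (m : 'I_3 -> 'I_3 -> mark) :
    diagram R -> diagram R -> Prop :=
  local_move (tangle3 (1 : R) m) (tangle3 (-1 : R) m).

(* All crossings are classical, and the strands lie at three distinct heights. *)
Definition marks_classical3 (m : 'I_3 -> 'I_3 -> mark) : Prop :=
  exists2 h : 'I_3 -> nat, injective h &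
    forall i j, i != j -> m i j = if (h j < h i)%N then Over else Under.

Definition marks_virtual3 (m : 'I_3 -> 'I_3 -> mark) : Prop :=
  forall i j, i != j -> m i j = Virtual.

(* Strand [k] meets the two others virtually, and these cross classically. *)
Definition marks_mixed (m : 'I_3 -> 'I_3 -> mark) : Prop :=
  (forall i j, i != j -> m j i = flip (m i j)) /\
  exists k, (forall j, j != k -> m k j = Virtual) /\
    (forall i j, i != j -> i != k -> j != k -> m i j <> Virtual).

(* Strand [k] passes over the two others, and these cross virtually. *)
Definition marks_welded (m : 'I_3 -> 'I_3 -> mark) : Prop :=
  (forall i j, i != j -> m j i = flip (m i j)) /\
  exists k, (forall j, j != k -> m k j = Over) /\
    (forall i j, i != j -> i != k -> j != k -> m i j = Virtual).

(** * Equivalences *)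

Inductive rotational_welded_step (R : realType) (D D' : diagram R) : Prop :=
| step_isotopy of planar_isotopic D D'
| step_classical1 m of m <> Virtual & move1 m D D'
| step_classical2 m of m <> Virtual & move2 m D D'
| step_classical3 m of marks_classical3 m & move3 m D D'
| step_virtual2 of move2 Virtual D D'
| step_virtual3 m of marks_virtual3 m & move3 m D D'
| step_mixed m of marks_mixed m & move3 m D D'
| step_welded m of marks_welded m & move3 m D D'.

Inductive welded_step (R : realType) (D D' : diagram R) : Prop :=
| step_rotational of rotational_welded_step D D'
| step_virtual1 of move1 Virtual D D'.

Definition rotational_welded_equivalent (R : realType) :
    diagram R -> diagram R -> Prop :=
  clos_refl_sym_trans (diagram R) (@rotational_welded_step R).

Definition welded_equivalent (R : realType) : diagram R -> diagram R -> Prop :=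
  clos_refl_sym_trans (diagram R) (@welded_step R).

(* Main.v *)
Require Import Defs.
From mathcomp Require Import all_boot all_order all_algebra finmap.
From mathcomp Require Import all_classical all_reals all_analysis.
From mathcomp Require Import ring lra.
From Stdlib Require Import Relation_Operators.

(** The invariant is the parity of the number of virtual crossings.  Each move
    of the rotational welded equivalence preserves it: the virtual move II
    creates or removes two virtual crossings, the classical moves I and II
    involve no virtual crossing, and the two sides of a triangle move have the
    same pairs of strands crossing with the same marks.  The virtual move I changes
    the number of virtual crossings by one, so the two diagrams of any virtual
    move I are welded equivalent but not rotational welded equivalent.

    For the first half, a local move leaves the diagram unchanged off its disc,
    so the change of parity depends only on the two model tangles
    ([local_move_parity]); the triangle moves are all settled by one symmetry
    ([tangle_virtual_points_half_turn]).  An isotopy carries the virtual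
    crossings of one diagram bijectively onto those of the other
    ([isotopy_parity]).  Together these give [rotational_welded_parity].

    For the second half, [loop_move1] exhibits a virtual move I between actual
    C^1 diagrams: an embedded oval containing a straight segment, and the same
    oval with that segment replaced by the model curl.  Both are given by
    explicit piecewise polynomial formulas. *)

Set Implicit Arguments.
Unset Strict Implicit.
Unset Printing Implicit Defensive.

Import Order.TTheory GRing.Theory Num.Theory.
Import numFieldNormedType.Exports.

Local Open Scope classical_set_scope.
Local Open Scope ring_scope.

(** * Parity of the cardinal of a finite set *)

Definition parity (T : choiceType) (A : set T) : bool := odd #|` fset_set A|.

Lemma parity0 (T : choiceType) : parity (set0 : set T) = false.
Proof. by rewrite /parity fset_set0 cardfs0. Qed.

Lemma parity1 (T : choiceType) (x : T) : parity [set x] = true.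
Proof. by rewrite /parity fset_set1 cardfs1. Qed.

Lemma parity_image (T U : choiceType) (f : T -> U) (A : set T) :
  finite_set A -> injective f -> parity (f @` A) = parity A.
Proof. by move=> fA fI; rewrite /parity fset_set_image // card_imfset. Qed.

Lemma parityU (T : choiceType) (A B : set T) :
  finite_set A -> finite_set B -> A `&` B = set0 ->
  parity (A `|` B) = parity A (+) parity B.
Proof.
move=> fA fB AB0; rewrite /parity fset_setU // cardfsU -fset_setI //.
by rewrite AB0 fset_set0 cardfs0 subn0 oddD.
Qed.

Lemma finite_image_inj (T U : Type) (f : T -> U) (A : set T) :
  injective f -> finite_set (f @` A) -> finite_set A.
Proof.
move=> fI fA; have : finite_set (f @^-1` (f @` A)).
  by apply: finite_preimage => // x y _ _; exact: fI.
by apply: sub_finite_set => x Ax /=; exists x.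
Qed.

(** * Parameters modulo 1 *)

Lemma same_param_refl (R : realType) (s : R) : same_param s s.
Proof. by rewrite /same_param subrr. Qed.

Lemma same_param_sym (R : realType) (s t : R) : same_param s t -> same_param t s.
Proof. by rewrite /same_param => st; rewrite -opprB rpredN. Qed.

Lemma same_param_trans (R : realType) (s t u : R) :
  same_param s t -> same_param t u -> same_param s u.
Proof. by move=> st tu; rewrite /same_param -(subrKA t) rpredD. Qed.

Lemma same_param_natr (R : realType) (n : nat) (s : R) :
  same_param (s + n%:R) s.
Proof. by rewrite /same_param addrAC subrr add0r rpred_nat. Qed.

Lemma curve_natr (R : realType) (D : diagram R) (n : nat) (s : R) :
  curve D (s + n%:R) = curve D s.
Proof.
elim: n => [|n IHn]; first by rewrite addr0.
by rewrite -natr1 addrA (gi_periodic (curve_generic D)).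
Qed.

Lemma same_paramP (R : realType) (s t : R) :
  same_param s t -> exists n : nat, s = t + n%:R \/ t = s + n%:R.
Proof.
move=> /intrP[[n|n] e].
  by exists n; left; rewrite -[s](subrK t) e addrC.
exists n.+1; right; rewrite -[t](subrK s) -opprB e NegzE intrN opprK.
by rewrite addrC.
Qed.

Lemma curve_same (R : realType) (D : diagram R) (s t : R) :
  same_param s t -> curve D s = curve D t.
Proof. by move=> /same_paramP[n [] ->]; rewrite curve_natr. Qed.

Lemma double_pair_sym (R : realType) (f : R -> R * R) (s t : R) :
  double_pair f s t -> double_pair f t s.
Proof. by case=> e nst; split=> // /same_param_sym. Qed.

Lemma double_pair_same (R : realType) (D : diagram R) (s s' t t' : R) :
  same_param s s' -> same_param t t' ->
  double_pair (curve D) s t -> double_pair (curve D) s' t'.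
Proof.
move=> ss tt [e nst]; split; first by rewrite -(curve_same D ss) -(curve_same D tt).
move=> s't'; apply: nst; apply: same_param_trans ss _.
exact: same_param_trans s't' (same_param_sym tt).
Qed.

Lemma crossing_samel (R : realType) (D : diagram R) (s s' t : R) :
  same_param s s' -> double_pair (curve D) s t ->
  crossing D s' t = crossing D s t.
Proof.
have H n u : double_pair (curve D) u t ->
    crossing D (u + n%:R) t = crossing D u t.
  move=> dut; elim: n => [|n IHn]; first by rewrite addr0.
  rewrite -natr1 addrA crossing_periodic //.
  apply: double_pair_same dut; last exact: same_param_refl.
  by apply: same_param_sym; exact: same_param_natr.
move=> ss dst; have ds't := double_pair_same ss (same_param_refl t) dst.
by case: (same_paramP ss) => n [] e; rewrite e H // -e.
Qed.

(** Periodicity in the first parameter is part of a diagram; the second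
    parameter is reached by flipping, shifting and flipping back. *)
Lemma crossing_same (R : realType) (D : diagram R) (s s' t t' : R) :
  same_param s s' -> same_param t t' -> double_pair (curve D) s t ->
  crossing D s' t' = crossing D s t.
Proof.
move=> ss tt dst; have ds't := double_pair_same ss (same_param_refl t) dst.
rewrite -(crossing_samel ss dst).
rewrite (crossing_flip (double_pair_sym ds't)).
have dts' := double_pair_sym ds't.
rewrite -(crossing_samel tt dts') crossing_flip //.
exact: double_pair_same tt (same_param_refl s') dts'.
Qed.

(** * Virtual crossings and local moves *)

Definition virtual_points (R : realType) (D : diagram R) : set (R * R) :=
  [set p | exists s t, [/\ double_pair (curve D) s t, curve D s = p &
                           crossing D s t = Virtual]].

Lemma finite_virtual_points (R : realType) (D : diagram R) :
  finite_set (virtual_points D).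
Proof.
apply: sub_finite_set (gi_finite (curve_generic D)).
by move=> p [s [t [dst sp _]]]; exists s, t.
Qed.

Definition tangle_virtual_points (R : realType) (n : nat) (T : tangle R n) :
    set (R * R) :=
  [set p | exists i j s t,
     [/\ -1 <= s <= 1 /\ -1 <= t <= 1, ~ (i = j /\ s = t),
         strand T i s = p, strand T j t = p & tmark T i s j t = Virtual]].

Definition in_box (R : realType) (n : nat) (T : tangle R n) : Prop :=
  forall i t, -1 <= t <= 1 -> @box R (strand T i t).

Definition outer_virtual_points (R : realType) (n : nat) (c r : 'I_n -> R)
    (D : diagram R) : set (R * R) :=
  [set p | exists s t, [/\ ~ strand_param c r s, ~ strand_param c r t,
     double_pair (curve D) s t, curve D s = p & crossing D s t = Virtual]].

(** A strand of the tangle stays in the disc and any passage through the disc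
    is a strand, so no crossing involves one passage of each kind. *)
Lemma virtual_points_split (R : realType) (n : nat) (e : R * R -> R * R)
    (c r : 'I_n -> R) (T : tangle R n) (D : diagram R) :
  injective e -> disjoint_strands c r -> contains e c r T D -> in_box T ->
  virtual_points D =
    outer_virtual_points c r D `|` e @` tangle_virtual_points T.
Proof.
move=> eI [_ dis] [cur onbox mk] inb.
have strand_box s : strand_param c r s -> (e @` @box R) (curve D s).
  case=> i [t [ht /(curve_same D) ->]]; rewrite cur //.
  by exists (strand T i t) => //; exact: inb.
apply/seteqP; split=> p.
  case=> s [t [dst sp vst]].
  case: (pselect (strand_param c r s)) => [ps|nps].
    have pt : strand_param c r t.
      by apply: onbox; case: dst => <- _; exact: strand_box.
    right; case: ps pt => i [a [ha sa]] [j [b [hb tb]]].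
    have dab := double_pair_same sa tb dst.
    have := crossing_same sa tb dst; rewrite vst mk // => vab.
    exists (strand T i a); last by rewrite -cur // -(curve_same D sa).
    exists i, j, a, b; split=> //.
      by case=> ij ab; case: dab => _; apply; rewrite ij ab; exact: same_param_refl.
    by apply: eI; rewrite -!cur //; case: dab.
  left; exists s, t; split=> // pt; apply: nps.
  by apply: onbox; case: dst => -> _; exact: strand_box.
case; first by case=> s [t [_ _ dst sp vst]]; exists s, t.
case=> _ [i [j [a [b [[ha hb] nab <- ba vab]]]]] <-.
have dab : double_pair (curve D) (c i + r i * a) (c j + r j * b).
  by split; [rewrite !cur // ba | move=> /dis-/(_ ha hb)].
by exists (c i + r i * a), (c j + r j * b); split=> //; rewrite ?cur // mk.
Qed.

(** A virtual crossing outside the strands cannot lie in the disc, so the union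
    of [virtual_points_split] is disjoint and the parities add. *)
Lemma parity_split (R : realType) (n : nat) (e : R * R -> R * R)
    (c r : 'I_n -> R) (T : tangle R n) (D : diagram R) :
  injective e -> disjoint_strands c r -> contains e c r T D -> in_box T ->
  parity (virtual_points D) =
    parity (outer_virtual_points c r D) (+) parity (tangle_virtual_points T).
Proof.
move=> eI dis cD inb; have := virtual_points_split eI dis cD inb => VE.
have := finite_virtual_points D; rewrite VE finite_setU => -[fO fI].
rewrite parityU // ?parity_image //; first exact: finite_image_inj eI fI.
apply/seteqP; split=> // _ [[s [t [ns _ _ <- _]]]].
case=> _ [i [j [a [b [[ha hb] nab <- _ _]]]]] es; apply: ns.
case: cD => _ onbox _; apply: onbox; rewrite -es.
by exists (strand T i a) => //; exact: inb.
Qed.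

Lemma outer_virtual_points_sub (R : realType) (n : nat) (c r : 'I_n -> R)
    (D D' : diagram R) :
  (forall s, ~ strand_param c r s -> curve D s = curve D' s) ->
  (forall s t, ~ strand_param c r s -> ~ strand_param c r t ->
     double_pair (curve D) s t -> crossing D s t = crossing D' s t) ->
  outer_virtual_points c r D `<=` outer_virtual_points c r D'.
Proof.
move=> cE mE p [s [t [ns nt dst sp vst]]].
exists s, t; split=> //; last 2 first.
- by rewrite -cE.
- by rewrite -mE.
by case: dst => e nst; split=> //; rewrite -!cE.
Qed.

Lemma diffeo_inj (R : realType) (e : R * R -> R * R) : diffeo e -> injective e.
Proof. by case=> _ [g [_ + _]]; exact: can_inj. Qed.

(** The contribution of the crossings outside the strands is common to both
    diagrams and cancels. *)
Lemma local_move_parity (R : realType) (n : nat) (T T' : tangle R n)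
    (D D' : diagram R) :
  in_box T -> in_box T' -> local_move T T' D D' ->
  parity (virtual_points D) (+) parity (virtual_points D') =
  parity (tangle_virtual_points T) (+) parity (tangle_virtual_points T').
Proof.
move=> bT bT' [e [c [r [[/diffeo_inj eI dis] cD cD' cE mE]]]].
rewrite (parity_split eI dis cD bT) (parity_split eI dis cD' bT').
suff -> : outer_virtual_points c r D = outer_virtual_points c r D'.
  by rewrite addbACA addbb.
apply/seteqP; split; first exact: outer_virtual_points_sub.
apply: outer_virtual_points_sub => [s ns|s t ns nt [e' nst]]; first by rewrite cE.
by rewrite mE //; split=> //; rewrite !cE.
Qed.

(** * Virtual crossings of the model tangles *)

Lemma flip_neqV (m : mark) : m <> Virtual -> flip m <> Virtual.
Proof. by case: m. Qed.

Lemma in_box_flat (R : realType) : in_box (tangle1_flat R).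
Proof. by move=> i t ht; rewrite /box /= ht /=; lra. Qed.

Lemma sqr_1B_range (R : realType) (t : R) :
  -1 <= t <= 1 -> 0 <= (1 - t ^+ 2) ^+ 2 <= 1.
Proof.
move=> ht; rewrite sqr_ge0 -[leRHS](expr1n _ 2) /=.
by rewrite ler_sqr ?nnegrE //; nra.
Qed.

(** In this form the abscissa shares the factor [(1 - t^2)^2] with the ordinate. *)
Lemma curl_abscissa (R : realType) (t : R) :
  - t + 4 * t ^+ 3 - 2 * t ^+ 5 = t * (1 - 2 * (1 - t ^+ 2) ^+ 2).
Proof. by ring. Qed.

Lemma in_box_curl (R : realType) (m : mark) : in_box (tangle1_curl R m).
Proof.
move=> i t ht; have := sqr_1B_range ht; rewrite /box /= curl_abscissa.
move: ((1 - t ^+ 2) ^+ 2) => w hw.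
have : `|t * (1 - 2 * w)| <= 1.
  by rewrite normrM mulr_ile1 // ler_norml; lra.
by rewrite ler_norml; lra.
Qed.

Lemma in_box_apart (R : realType) : in_box (tangle2_apart R).
Proof. by move=> i t ht; rewrite /box /=; case: ifP => _ /=; lra. Qed.

Lemma in_box_crossed (R : realType) (m : mark) : in_box (tangle2_crossed R m).
Proof.
move=> i t ht; have := sqr_1B_range ht; rewrite /box /=.
by case: ifP => _ /=; lra.
Qed.

Lemma in_box_tangle3 (R : realType) (a : R) m :
  -1 <= a <= 1 -> in_box (tangle3 a m).
Proof.
move=> ha i t ht; have := sqr_1B_range ht; rewrite /box /=.
by move: ((1 - t ^+ 2) ^+ 2) => w hw; case: (val i) => [|[|k]] /=; nra.
Qed.

Lemma sqr_eq_opp (R : realType) (s t : R) :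
  s ^+ 2 = t ^+ 2 -> s <> t -> t = - s.
Proof.
move=> /eqP; rewrite eqf_sqr => /orP[/eqP|/eqP ->]; first by [].
by rewrite opprK.
Qed.

Lemma sqr_1B_inj (R : realType) (s t : R) : -1 <= s <= 1 -> -1 <= t <= 1 ->
  (1 - s ^+ 2) ^+ 2 = (1 - t ^+ 2) ^+ 2 -> s ^+ 2 = t ^+ 2.
Proof. by move=> hs ht /eqP; rewrite eqf_sqr => /orP[] /eqP e; nra. Qed.

(** Only opposite parameters can collide in the curl, since the ordinate is a
    monotone function of [t^2]; the abscissa then has to vanish. *)
Lemma curl_double (R : realType) (s t : R) :
  -1 <= s <= 1 -> -1 <= t <= 1 -> s <> t ->
  s * (1 - 2 * (1 - s ^+ 2) ^+ 2) = t * (1 - 2 * (1 - t ^+ 2) ^+ 2) ->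
  (1 - s ^+ 2) ^+ 2 = (1 - t ^+ 2) ^+ 2 ->
  t = - s /\ (1 - s ^+ 2) ^+ 2 = 2^-1.
Proof.
move=> hs ht nst ex ey; have e2 := sqr_1B_inj hs ht ey.
have ets := sqr_eq_opp e2 nst; split=> //.
have s0 : s != 0 by apply/eqP => s0; apply: nst; rewrite ets s0 oppr0.
rewrite -ey ets in ex.
have : s * (1 - 2 * (1 - s ^+ 2) ^+ 2) = 0 by lra.
by move=> /eqP; rewrite mulf_eq0 (negPf s0) /= => /eqP; lra.
Qed.

Lemma half_root (R : realType) :
  exists t : R, [/\ 0 < t, t < 1 & (1 - t ^+ 2) ^+ 2 = 2^-1].
Proof.
have h0 : (0 : R) <= 2^-1 by lra.
pose u : R := Num.sqrt 2^-1.
have u0 : 0 < u by rewrite sqrtr_gt0; lra.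
have u2 : u ^+ 2 = 2^-1 by rewrite sqr_sqrtr.
have u1 : u < 1 by nra.
have v0 : 0 < 1 - u by lra.
exists (Num.sqrt (1 - u)); rewrite sqrtr_gt0; split=> //.
  have := sqr_sqrtr (ltW v0); have := sqrtr_ge0 (1 - u).
  by move: (Num.sqrt _) => w; nra.
by rewrite sqr_sqrtr ?ltW // opprB addrC subrK.
Qed.

Lemma virtual_points_flat (R : realType) :
  tangle_virtual_points (tangle1_flat R) = set0.
Proof.
apply/seteqP; split=> // p [i [j [s [t [_ nst /= <- [/esym st] _]]]]].
by apply: nst; rewrite (ord1 i) (ord1 j).
Qed.

Lemma virtual_points_curl_classical (R : realType) (m : mark) : m <> Virtual ->
  tangle_virtual_points (tangle1_curl R m) = set0.
Proof.
move=> mV; apply/seteqP; split=> // p [i [j [s [t [_ _ _ _ /=]]]]].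
by case: ifP => _ //; exact: flip_neqV.
Qed.

(** The only crossing is on the axis, at the height where [(1 - t^2)^2] is 1/2. *)
Lemma virtual_points_curl (R : realType) :
  tangle_virtual_points (tangle1_curl R Virtual) = [set (0, 2^-1)].
Proof.
apply/seteqP; split=> p.
  case=> i [j [s [t [[hs ht] nst /= <- e _]]]].
  have {}nst : s <> t by move=> st; apply: nst; rewrite (ord1 i) (ord1 j).
  case: e; rewrite !curl_abscissa => /esym ex /esym ey.
  by have [_ e] := curl_double hs ht nst ex ey; rewrite e; congr (_, _); field.
move=> ->; have [t [t0 t1 et]] := half_root R.
have tE (u : R) : u ^+ 2 = t ^+ 2 ->
    (- u + 4 * u ^+ 3 - 2 * u ^+ 5, (1 - u ^+ 2) ^+ 2) = (0, 2^-1).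
  by move=> u2; rewrite curl_abscissa u2 et; congr (_, _); field.
exists ord0, ord0, t, (- t); split=> /=; first by split; lra.
- by case=> _; lra.
- exact: tE.
- by apply: tE; rewrite sqrrN.
- by case: ifP.
Qed.

Lemma virtual_points_apart (R : realType) :
  tangle_virtual_points (tangle2_apart R) = set0.
Proof.
apply/seteqP; split=> // p [i [j [s [t [_ nst /= <- e _]]]]]; apply: nst.
case: (i =P ord0) e => [->|/eqP i0]; case: (j =P ord0) => [->|/eqP j0] /=.
- by case=> ->.
- by rewrite ifN //= => -[_]; lra.
- by rewrite ifN //= => -[_]; lra.
- rewrite !ifN //= => -[->]; split=> //.
  by apply: val_inj; move: i j i0 j0 => [[|[|]] //= ?] [[|[|]] //=].
Qed.

Lemma virtual_points_crossed_classical (R : realType) (m : mark) :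
  m <> Virtual -> tangle_virtual_points (tangle2_crossed R m) = set0.
Proof.
move=> mV; apply/seteqP; split=> // p [i [j [s [t [_ _ _ _ /=]]]]].
by rewrite /mark2; case: ifP => _ //; exact: flip_neqV.
Qed.

(** The two crossings are at the opposite roots of [2 (1 - t^2)^2 = 1]. *)
Lemma virtual_points_crossed (R : realType) :
  parity (tangle_virtual_points (tangle2_crossed R Virtual)) = false.
Proof.
have [t [t0 t1 et]] := half_root R.
have : tangle_virtual_points (tangle2_crossed R Virtual) =
    [set (t, 0)] `|` [set (- t, 0)].
  have uE (u : R) : -1 <= u <= 1 -> 1 - 2 * (1 - u ^+ 2) ^+ 2 = 0 ->
      [set (t, 0); (- t, 0)] (u, 0).
    move=> hu u2; have /eqP : u ^+ 2 = t ^+ 2.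
      by apply: sqr_1B_inj => //; lra.
    by rewrite eqf_sqr => /orP[] /eqP ->; [left|right].
  apply/seteqP; split=> p.
    case=> i [j [s [u [[hs hu] nsu /= <- e _]]]].
    case: (i =P ord0) e => [i0|/eqP i0]; case: (j =P ord0) => [j0|/eqP j0] /=.
    - by rewrite i0 j0 => -[us]; case: nsu; rewrite i0 j0 us.
    - by rewrite i0 ifN //= => -[us] u2; rewrite -us; apply: uE.
    - by rewrite j0 ifN //= => -[us] s2; rewrite -s2; apply: uE.
    - rewrite !ifN //= => -[us] _; case: nsu; split=> //.
      by apply: val_inj; move: i j i0 j0 => [[|[|]] //= ?] [[|[|]] //=].
  have pE (u : R) : u ^+ 2 = t ^+ 2 -> 0 = 1 - 2 * (1 - u ^+ 2) ^+ 2.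
    by move=> ->; rewrite et; field.
  case=> ->.
    exists ord0, ord_max, t, t; split=> //=; first by split; lra.
    - by case.
    - by rewrite -pE.
  exists ord0, ord_max, (- t), (- t); split=> //=; first by split; lra.
  - by case.
  - by rewrite -pE // sqrrN.
move=> ->; rewrite parityU ?parity1 //.
by apply/seteqP; split=> // _ [-> []]; lra.
Qed.

(** The two sides of a triangle move are exchanged by the half-turn about the
    centre of the box, whatever the marks. *)
Lemma tangle_virtual_points_half_turn (R : realType) (a : R) m :
  -%R @` tangle_virtual_points (tangle3 a m) `<=`
  tangle_virtual_points (tangle3 (- a) m).
Proof.
have turn i t : strand (tangle3 (- a) m) i (- t) = - strand (tangle3 a m) i t.
  rewrite /=; case: (val i) => [|[|k]] //=.
  by rewrite sqrrN !mulNr.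
move=> _ [p [i [j [s [t [[hs ht] nst sp tp vst]]]]] <-].
exists i, j, (- s), (- t); split=> //; first by split; lra.
- by case=> ij /oppr_inj st; apply: nst.
- by rewrite turn sp.
- by rewrite turn tp.
Qed.

Lemma local_move_finite (R : realType) (n : nat) (T T' : tangle R n)
    (D D' : diagram R) : in_box T -> local_move T T' D D' ->
  finite_set (tangle_virtual_points T).
Proof.
move=> bT [e [c [r [[/diffeo_inj eI dis] cD _ _ _]]]].
have := finite_virtual_points D; rewrite (virtual_points_split eI dis cD bT).
by rewrite finite_setU => -[_]; exact: finite_image_inj eI.
Qed.

Lemma move3_parity (R : realType) m (D D' : diagram R) : move3 m D D' ->
  parity (virtual_points D) = parity (virtual_points D').
Proof.
have b1 : in_box (tangle3 (1 : R) m) by apply: in_box_tangle3; lra.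
have bN1 : in_box (tangle3 (- 1 : R) m) by apply: in_box_tangle3; lra.
move=> mv; have := local_move_parity b1 bN1 mv.
suff <- : -%R @` tangle_virtual_points (tangle3 (1 : R) m) =
          tangle_virtual_points (tangle3 (- 1 : R) m).
  rewrite parity_image ?addbb; last exact: oppr_inj.
    by case: (parity _); case: (parity _).
  exact: local_move_finite b1 mv.
apply/seteqP; split; first exact: tangle_virtual_points_half_turn.
move=> p Tp; exists (- p); last by rewrite opprK.
rewrite -[X in tangle3 X]opprK; apply: tangle_virtual_points_half_turn.
by exists p.
Qed.

(** * The invariant *)

Lemma C1_derivable (R : realType) (V : normedModType R) (f : R -> V) (s : R) :
  C1 f -> derivable f s 1.
Proof. by case=> df _; apply/derivable1_diffP. Qed.

Lemma reparam_inj (R : realType) (h : R -> R) : reparam h -> injective h.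
Proof.
case=> hC1 h' _; have mono a b : a < b -> h a < h b.
  move=> ab; apply: (@gtr0_derive1_lt_cc _ h a b) => //.
  - by move=> x _; exact: C1_derivable.
  - apply: derivable_within_continuous => x _; exact: C1_derivable.
  - by rewrite in_itv /= lexx ltW.
  - by rewrite in_itv /= lexx ltW.
by apply: inc_inj; exact: le_mono.
Qed.

Lemma reparam_add_nat (R : realType) (h : R -> R) (n : nat) (s : R) :
  reparam h -> h (s + n%:R) = h s + n%:R.
Proof.
case=> _ _ hp; elim: n => [|n IHn]; first by rewrite !addr0.
by rewrite -natr1 !addrA hp IHn.
Qed.

Lemma reparam_same (R : realType) (h : R -> R) (s t : R) :
  reparam h -> same_param (h s) (h t) <-> same_param s t.
Proof.
move=> rh; split.
  case/same_paramP=> n []; rewrite -reparam_add_nat // => /(reparam_inj rh) ->.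
    exact: same_param_natr.
  exact: same_param_sym (same_param_natr _ _).
case/same_paramP=> n [] ->; rewrite reparam_add_nat //.
  exact: same_param_natr.
exact: same_param_sym (same_param_natr _ _).
Qed.

(** The values at large integers are arbitrarily far away on both sides, since
    [h] commutes with integer translations. *)
Lemma reparam_surj (R : realType) (h : R -> R) (y : R) :
  reparam h -> exists s, h s = y.
Proof.
move=> rh; pose n := Num.bound `|y - h 0|.
have hn : `|y - h 0| < n%:R by exact: archi_boundP.
have e1 : h n%:R = h 0 + n%:R by rewrite -[in LHS](add0r n%:R) reparam_add_nat.
have e2 : h (- n%:R) = h 0 - n%:R.
  by rewrite -(addNr n%:R) reparam_add_nat // addrK.
move: hn; rewrite ltr_norml => hn.
have [|||s _ <-] := @IVT R h (- n%:R) n%:R y; last by exists s.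
- by rewrite ge0_cp.
- apply: derivable_within_continuous => x _; apply: C1_derivable.
  by case: rh.
- by rewrite e1 e2 minElt maxElt; case: ifP; lra.
Qed.

(** Only the final diffeomorphism of the isotopy matters: it is injective, and
    surjectivity of the reparametrization makes it hit every virtual crossing. *)
Lemma isotopy_parity (R : realType) (D D' : diagram R) : planar_isotopic D D' ->
  parity (virtual_points D) = parity (virtual_points D').
Proof.
case=> H [h [[_ dH _] rh cE mE]].
have HI : injective (H 1) by apply/diffeo_inj/dH; lra.
suff -> : virtual_points D' = H 1 @` virtual_points D.
  by rewrite parity_image //; exact: finite_virtual_points.
have dE s t : double_pair (curve D') (h s) (h t) <-> double_pair (curve D) s t.
  rewrite /double_pair !cE; split=> -[e nst]; split.
  - exact: HI.
  - by move=> /(reparam_same _ _ rh).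
  - by rewrite e.
  - by move=> /(reparam_same _ _ rh).
apply/seteqP; split=> p.
  case=> s' [t' []]; have [s <-] := reparam_surj s' rh.
  have [t <-] := reparam_surj t' rh => /dE dst <-; rewrite mE // => vst.
  by exists (curve D s); [exists s, t | rewrite cE].
case=> _ [s [t [dst <- vst]]] <-.
by exists (h s), (h t); split; [apply/dE | rewrite cE | rewrite mE].
Qed.

Lemma move1_parity (R : realType) (m : mark) (D D' : diagram R) :
  m <> Virtual -> move1 m D D' ->
  parity (virtual_points D) = parity (virtual_points D').
Proof.
move=> mV mv.
have := local_move_parity (@in_box_flat R) (@in_box_curl R m) mv.
rewrite virtual_points_flat virtual_points_curl_classical // addbb.
by case: (parity _); case: (parity _).
Qed.

Lemma move1_virtual_parity (R : realType) (D D' : diagram R) :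
  move1 Virtual D D' -> parity (virtual_points D) <> parity (virtual_points D').
Proof.
move=> mv.
have := local_move_parity (@in_box_flat R) (@in_box_curl R Virtual) mv.
rewrite virtual_points_flat virtual_points_curl parity0 parity1.
by case: (parity _); case: (parity _).
Qed.

Lemma move2_parity (R : realType) (m : mark) (D D' : diagram R) :
  move2 m D D' ->
  parity (virtual_points D) = parity (virtual_points D').
Proof.
move=> mv.
have := local_move_parity (@in_box_apart R) (@in_box_crossed R m) mv.
have -> : parity (tangle_virtual_points (tangle2_crossed R m)) = false.
  case: (pselect (m = Virtual)) => [->|mV].
    exact: virtual_points_crossed.
  by rewrite virtual_points_crossed_classical // parity0.
rewrite virtual_points_apart parity0.
by case: (parity _); case: (parity _).
Qed.

Lemma rotational_welded_parity (R : realType) (D D' : diagram R) :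
  rotational_welded_equivalent D D' ->
  parity (virtual_points D) = parity (virtual_points D').
Proof.
elim=> {D D'} [D D'||D D' _ -> //|D1 D2 D3 _ -> _ -> //]; last by [].
by case; [exact: isotopy_parity | move=> m mV; exact: move1_parity mV
  | move=> m _; exact: move2_parity | move=> m _; exact: move3_parity
  | exact: move2_parity | move=> m _; exact: move3_parity
  | move=> m _; exact: move3_parity | move=> m _; exact: move3_parity].
Qed.

(** * Continuously differentiable curves *)

Definition ramp (R : realType) (x : R) : R := Num.max 0 x.

Lemma ramp_pos (R : realType) (x : R) : 0 <= x -> ramp x = x.
Proof. by move=> x0; apply/max_idPr. Qed.

Lemma ramp_neg (R : realType) (x : R) : x <= 0 -> ramp x = 0.
Proof. by move=> x0; apply/max_idPl. Qed.

Lemma ramp_continuous (R : realType) : continuous (@ramp R).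
Proof.
move=> x; apply: (@continuous_max R R (fun=> 0) id x); first exact: cvg_cst.
exact: cvg_id.
Qed.

(** A criterion that treats the gluing points of a piecewise polynomial like
    any other point. *)
Lemma is_derive_quadratic (R : realType) (f : R -> R) (x l : R) :
  (forall h, `|f (h + x) - f x - l * h| <= h ^+ 2) -> is_derive x 1 f l.
Proof.
move=> fl; suff : h^-1 *: (f (h *: 1 + x) - f x) @[h --> 0^'] --> l.
  by move=> H; split; [apply/cvg_ex; exists l | exact: cvg_lim H].
apply/cvgrPdist_lt => eps eps0; near=> h.
have h0 : h != 0 by near: h; exact: nbhs_dnbhs_neq.
have -> : l - h^-1 *: (f (h *: 1 + x) - f x) =
    - (h^-1 * (f (h + x) - f x - l * h)).
  by rewrite /GRing.scale /= mulr1; field.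
rewrite normrN normrM; apply: (@le_lt_trans _ _ (`|h^-1| * h ^+ 2)).
  by rewrite ler_wpM2l.
rewrite -real_normK ?num_real // normfV expr2 mulKf ?normr_eq0 //.
by near: h; exact: dnbhs0_lt.
Unshelve. all: by end_near. Qed.

(** Squaring makes the positive part continuously differentiable. *)
Definition ramp2 (R : realType) (x : R) : R := ramp x ^+ 2.

Lemma is_derive_ramp2 (R : realType) (x : R) :
  is_derive x 1 (@ramp2 R) (2 * ramp x).
Proof.
apply: is_derive_quadratic => h; rewrite /ramp2 ler_norml.
case: (leP 0 x) => x0; case: (leP 0 (h + x)) => hx.
- by rewrite !ramp_pos //; nra.
- by rewrite (ramp_pos x0) (ramp_neg (ltW hx)); nra.
- by rewrite (ramp_pos hx) (ramp_neg (ltW x0)); nra.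
- by rewrite (ramp_neg (ltW hx)) (ramp_neg (ltW x0)); nra.
Qed.

Lemma is_derive_ramp2_comp (R : realType) (u : R -> R) (x du : R) :
  is_derive x 1 u du ->
  is_derive x 1 (fun y => ramp2 (u y)) (2 * ramp (u x) * du).
Proof. by move=> Hu; apply: (is_derive1_comp (is_derive_ramp2 (u x)) Hu). Qed.

Lemma is_derive_affine (R : realType) (a b x : R) :
  is_derive x 1 (fun y => a * y + b) a.
Proof.
apply: is_derive_quadratic => h.
have -> : a * (h + x) + b - (a * x + b) - a * h = 0 by ring.
by rewrite normr0 sqr_ge0.
Qed.

Lemma C1_pair (R : realType) (f1 f2 d1 d2 : R -> R) :
  (forall s : R, is_derive s 1 f1 (d1 s)) ->
  (forall s : R, is_derive s 1 f2 (d2 s)) ->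
  continuous d1 -> continuous d2 ->
  C1 (fun s => (f1 s, f2 s)) /\
  forall s : R, derive1 (fun s => (f1 s, f2 s)) s = (d1 s, d2 s).
Proof.
move=> D1 D2 c1 c2.
have F1 (s : R) : differentiable f1 s by apply/derivable1_diffP; case: (D1 s).
have F2 (s : R) : differentiable f2 s by apply/derivable1_diffP; case: (D2 s).
have dE (s v : R) : 'd (fun s : R => (f1 s, f2 s)) s v = (v * d1 s, v * d2 s).
  rewrite diff_pair //= -[v]mulr1 -[v * 1]/(v *: (1 : R)) !linearZ /=.
  rewrite -!deriveE // [v *: 1]mulr1.
  rewrite (@derive_val _ _ _ _ _ _ _ (D1 s)).
  by rewrite (@derive_val _ _ _ _ _ _ _ (D2 s)).
have df (s : R) : differentiable (fun s : R => (f1 s, f2 s)) s.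
  exact: differentiable_pair.
split; last by move=> s; rewrite derive1E' // dE !mul1r.
split=> // v; have -> : (fun s : R => 'd (fun s : R => (f1 s, f2 s)) s v) =
    fun s => (v * d1 s, v * d2 s) by apply/funext => u; rewrite dE.
move=> s; apply: (@cvg_pair _ _ _ _ (nbhs (v * d1 s)) (nbhs (v * d2 s))).
  by apply: cvgM; [exact: cvg_cst | exact: c1].
by apply: cvgM; [exact: cvg_cst | exact: c2].
Qed.

Definition stretch (R : realType) (k : R) (p : R * R) : R * R := (p.1, k * p.2).

Lemma C1_stretch (R : realType) (k : R) : C1 (@stretch R k).
Proof.
have fstD (x : R * R) : is_diff x fst fst.
  have c : continuous (fst : R * R -> R) by move=> y; exact: cvg_fst.
  by apply: DiffDef; [exact: linear_differentiable | rewrite diff_lin].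
have sndD (x : R * R) : is_diff x snd snd.
  have c : continuous (snd : R * R -> R) by move=> y; exact: cvg_snd.
  by apply: DiffDef; [exact: linear_differentiable | rewrite diff_lin].
have H (x : R * R) : is_diff x (@stretch R k) (@stretch R k).
  by apply: is_diff_pair; apply: (is_diffZ k).
split=> [x|v]; first by case: (H x).
have -> : (fun x => 'd (@stretch R k) x v) = fun=> stretch k v.
  by apply/funext => x; rewrite (@diff_val _ _ _ _ _ _ _ (H x)).
by move=> x; exact: cvg_cst.
Qed.

Lemma diffeo_stretch (R : realType) (k : R) : k != 0 -> diffeo (@stretch R k).
Proof.
move=> k0; split; first exact: C1_stretch.
exists (@stretch R k^-1); split; first exact: C1_stretch.
  by case=> x y; rewrite /stretch /= mulKf.
by case=> x y; rewrite /stretch /= mulVKf.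
Qed.

(** * Periodic functions from one period *)

(** The circle is cut at the integers and a period is rescaled to [-4, 4), so
    that a strand centred at parameter 1/2 with rate 1/8 is [-1, 1]. *)
Definition chart (R : realType) (s : R) : R := 8 * (s - (Num.floor s)%:~R) - 4.

Lemma chart_range (R : realType) (s : R) : -4 <= chart s < 4.
Proof.
have := floor_itv s; rewrite /chart intrD; move: ((Num.floor s)%:~R) => n.
by lra.
Qed.

Lemma chartE (R : realType) (n : int) (x : R) :
  -4 <= x < 4 -> chart (2^-1 + 8^-1 * x + n%:~R) = x.
Proof.
move=> hx; rewrite /chart (_ : Num.floor _ = n); first by field.
by apply: floor_def; rewrite intrD; lra.
Qed.

Lemma chartK (R : realType) (s : R) :
  s = 2^-1 + 8^-1 * chart s + (Num.floor s)%:~R.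
Proof. by rewrite /chart; field. Qed.

Lemma same_param_chart (R : realType) (s t : R) :
  same_param s t <-> chart s = chart t.
Proof.
split=> [/intrP[n e]|e].
  rewrite -[s](subrK t) e [in LHS](chartK t) addrC -addrA -intrD.
  by rewrite chartE // chart_range.
rewrite /same_param (chartK s) (chartK t) e opprD addrACA subrr add0r.
by rewrite rpredB // intr_int.
Qed.

(** This is enough for [g (chart s)] to be as smooth as [g] across the cut: on
    either side of an integer it is then [g] after one and the same affine map. *)
Definition seamless (R : realType) (g : R -> R) : Prop :=
  forall x, -5 < x < -3 -> g (x + 8) = g x.

Lemma near_chart (R : realType) (g : R -> R) (s : R) : seamless g ->
  \forall u \near s, g (8 * u + (- 8 * (Num.floor s)%:~R - 4)) = g (chart u).
Proof.
move=> sg; set n := Num.floor s; have := floor_itv s; rewrite -/n intrD => hs.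
(* 1/8 is one unit of the chart, the overlap that [seamless] grants. *)
have hl : n%:~R - 8^-1 < s by lra.
have hr : s < n%:~R + 1 by lra.
near=> u.
have ul : n%:~R - 8^-1 < u by near: u; exact: lt_nbhsr.
have ur : u < n%:~R + 1 by near: u; exact: lt_nbhsl.
rewrite /chart; case: (leP n%:~R u) => un.
  rewrite (_ : Num.floor u = n); first by congr (g _); ring.
  by apply: floor_def; rewrite intrD; lra.
rewrite (_ : Num.floor u = n - 1); last first.
  by apply: floor_def; rewrite subrK intrB; lra.
rewrite intrB -sg; last by lra.
by congr (g _); ring.
Unshelve. all: by end_near. Qed.

Lemma is_derive_chart (R : realType) (g : R -> R) (s dg : R) : seamless g ->
  is_derive (chart s) 1 g dg -> is_derive s 1 (fun u => g (chart u)) (dg * 8).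
Proof.
move=> sg Dg; apply: near_eq_is_derive (near_chart s sg) _.
apply: (@is_derive1_comp _ g _ _ _ _ _ (is_derive_affine _ _ _)).
by move: Dg; congr is_derive; rewrite /chart; ring.
Qed.

Lemma continuous_chart (R : realType) (g : R -> R) : seamless g ->
  continuous g -> continuous (fun u => g (chart u)).
Proof.
move=> sg cg s; have sE : 8 * s + (- 8 * (Num.floor s)%:~R - 4) = chart s.
  by rewrite /chart; ring.
apply: cvg_trans; first exact: near_eq_cvg (near_chart s sg).
rewrite -sE.
apply: (@cvg_comp _ _ _
  (fun u => 8 * u + (- 8 * (Num.floor s)%:~R - 4)) g); last exact: cg.
apply: cvgD; last exact: cvg_cst.
by apply: cvgM; [exact: cvg_cst | exact: cvg_id].
Qed.

(** * An oval with an optional curl *)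

(** The oval on [-4, 4].  The velocity of [ovalX] is 1 on [-1, 1], decreases
    linearly to -1 on [1, 3] and stays there up to 4; [ovalX] is odd.  The
    ordinate [ovalY] is even, 0 on [-1, 1], 2 beyond 3, and between them a
    strictly increasing function of [|x|]: a flat bottom, a flat top and two
    round sides. *)
Definition ovalX (R : realType) (x : R) : R :=
  x - 2^-1 * (ramp2 (x - 1) - ramp2 (x - 3)
              - (ramp2 (- x - 1) - ramp2 (- x - 3))).

Definition ovalY (R : realType) (x : R) : R :=
  ramp2 (x - 1) - 2 * ramp2 (x - 2) + ramp2 (x - 3)
  + (ramp2 (- x - 1) - 2 * ramp2 (- x - 2) + ramp2 (- x - 3)).

Definition ovalX' (R : realType) (x : R) : R :=
  1 - (ramp (x - 1) - ramp (x - 3) + ramp (- x - 1) - ramp (- x - 3)).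

Definition ovalY' (R : realType) (x : R) : R :=
  2 * (ramp (x - 1) - 2 * ramp (x - 2) + ramp (x - 3)
       - (ramp (- x - 1) - 2 * ramp (- x - 2) + ramp (- x - 3))).

(** When [b] holds, the bottom [(x, 0)] of the oval is replaced by the model curl
    with its height halved, whose difference from the flat strand is
    [(1 - x^2)^2] times [(- 2 x, 1/2)].  The cut-off [ramp2] extends this
    difference by 0 beyond [-1, 1]; the halved height keeps the image of the
    model box below the top of the oval. *)
Definition loopX (R : realType) (b : bool) (x : R) : R :=
  ovalX x - b%:R * (2 * x * ramp2 (1 - x ^+ 2)).

Definition loopY (R : realType) (b : bool) (x : R) : R :=
  ovalY x + b%:R * (2^-1 * ramp2 (1 - x ^+ 2)).

Definition loopX' (R : realType) (b : bool) (x : R) : R :=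
  ovalX' x - b%:R * (2 * ramp2 (1 - x ^+ 2) - 8 * x ^+ 2 * ramp (1 - x ^+ 2)).

Definition loopY' (R : realType) (b : bool) (x : R) : R :=
  ovalY' x - b%:R * (2 * x * ramp (1 - x ^+ 2)).

Lemma is_derive_ramp2_shift (R : realType) (a x : R) :
  is_derive x 1 (fun y => ramp2 (y - a)) (2 * ramp (x - a)).
Proof.
rewrite -[X in is_derive _ _ _ X]mulr1; apply: is_derive_ramp2_comp.
apply: is_derive_quadratic => h.
by rewrite (_ : _ - _ = 0) ?normr0 ?sqr_ge0 //; ring.
Qed.

Lemma is_derive_ramp2_flip (R : realType) (a x : R) :
  is_derive x 1 (fun y => ramp2 (- y - a)) (2 * ramp (- x - a) * -1).
Proof.
apply: is_derive_ramp2_comp.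
apply: is_derive_quadratic => h.
by rewrite (_ : _ - _ = 0) ?normr0 ?sqr_ge0 //; ring.
Qed.

Lemma is_derive_ovalX (R : realType) (x : R) : is_derive x 1 (@ovalX R) (ovalX' x).
Proof.
have S a := is_derive_ramp2_shift a x; have F a := is_derive_ramp2_flip a x.
have := is_deriveB (is_derive_id x 1) (is_deriveZ 2^-1
  (is_deriveB (is_deriveB (S 1) (S 3)) (is_deriveB (F 1) (F 3)))).
by move=> /is_derive_eq; apply; rewrite /ovalX' /GRing.scale /=; field.
Qed.

Lemma is_derive_ovalY (R : realType) (x : R) : is_derive x 1 (@ovalY R) (ovalY' x).
Proof.
have S a := is_derive_ramp2_shift a x; have F a := is_derive_ramp2_flip a x.
have := is_deriveD
  (is_deriveD (is_deriveB (S 1) (is_deriveZ 2 (S 2))) (S 3))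
  (is_deriveD (is_deriveB (F 1) (is_deriveZ 2 (F 2))) (F 3)).
by move=> /is_derive_eq; apply; rewrite /ovalY' /GRing.scale /=; ring.
Qed.

Lemma is_derive_bump (R : realType) (x : R) :
  is_derive x 1 (fun y => ramp2 (1 - y ^+ 2)) (- 4 * x * ramp (1 - x ^+ 2)).
Proof.
have -> : - 4 * x * ramp (1 - x ^+ 2) = 2 * ramp (1 - x ^+ 2) * (- 2 * x) by ring.
apply: is_derive_ramp2_comp; apply: is_derive_quadratic => h.
rewrite (_ : _ - _ = - h ^+ 2); last by ring.
by rewrite normrN ger0_norm ?sqr_ge0.
Qed.

Lemma is_derive_loopX (R : realType) b (x : R) :
  is_derive x 1 (@loopX R b) (loopX' b x).
Proof.
have := is_deriveB (is_derive_ovalX x) (is_deriveZ b%:R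
  (is_deriveM (is_deriveZ 2 (is_derive_id x 1)) (is_derive_bump x))).
by move=> /is_derive_eq; apply; rewrite /loopX' /= /GRing.scale /=; ring.
Qed.

Lemma is_derive_loopY (R : realType) b (x : R) :
  is_derive x 1 (@loopY R b) (loopY' b x).
Proof.
have := is_deriveD (is_derive_ovalY x) (is_deriveZ b%:R
  (is_deriveZ 2^-1 (is_derive_bump x))).
by move=> /is_derive_eq; apply; rewrite /loopY' /GRing.scale /=; field.
Qed.

Lemma continuous_ramp_comp (R : realType) (u : R -> R) :
  continuous u -> continuous (fun x => ramp (u x)).
Proof.
move=> cu x; apply: (@continuous_comp _ _ _ u (@ramp R)); first exact: cu.
exact: ramp_continuous.
Qed.

Lemma continuous_ramp_shift (R : realType) (a : R) :
  continuous (fun x : R => ramp (x - a)).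
Proof.
apply: continuous_ramp_comp => x.
by apply: cvgB; [exact: cvg_id | exact: cvg_cst].
Qed.

Lemma continuous_ramp_flip (R : realType) (a : R) :
  continuous (fun x : R => ramp (- x - a)).
Proof.
apply: continuous_ramp_comp => x.
by apply: cvgB; [apply: cvgN; exact: cvg_id | exact: cvg_cst].
Qed.

Lemma continuous_ramp_bump (R : realType) :
  continuous (fun x : R => ramp (1 - x ^+ 2)).
Proof.
apply: continuous_ramp_comp => x.
by apply: cvgB; [exact: cvg_cst | exact: exprn_continuous].
Qed.

Lemma continuous_loopX' (R : realType) b : continuous (@loopX' R b).
Proof.
move=> x; have S a := @continuous_ramp_shift R a x.
have F a := @continuous_ramp_flip R a x; have B := @continuous_ramp_bump R x.
apply: cvgB.
  apply: cvgB; first exact: cvg_cst.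
  apply: cvgB; last exact: F.
  by apply: cvgD; [apply: cvgB; exact: S | exact: F].
apply: cvgM; first exact: cvg_cst.
apply: cvgB; apply: cvgM; [exact: cvg_cst | | | exact: B].
  apply: (@continuous_comp _ _ _
    (fun y : R => ramp (1 - y ^+ 2)) (fun y => y ^+ 2)).
    exact: B.
  exact: exprn_continuous.
by apply: cvgM; [exact: cvg_cst | exact: exprn_continuous].
Qed.

Lemma continuous_loopY' (R : realType) b : continuous (@loopY' R b).
Proof.
move=> x; have S a := @continuous_ramp_shift R a x.
have F a := @continuous_ramp_flip R a x; have B := @continuous_ramp_bump R x.
have M c (f : R -> R) : f y @[y --> x] --> f x -> c * f y @[y --> x] --> c * f x.
  by move=> cf; apply: cvgM; [exact: cvg_cst | exact: cf].
apply: cvgB; apply: (M).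
  by apply: cvgB; apply: cvgD; try exact: S; try exact: F; apply: cvgB;
    try exact: S; try exact: F; apply: (M); [exact: S | exact: F].
by apply: cvgM; [apply: (M); exact: cvg_id | exact: B].
Qed.

(** Evaluates every [ramp] whose sign follows linearly from the context. *)
Ltac ramps := rewrite /ramp2; repeat match goal with
  | |- context [ramp ?t] => (rewrite (@ramp_pos _ t); [|lra]) ||
                            (rewrite (@ramp_neg _ t); [|lra]) end.

Lemma sqr_le1 (R : realType) (x : R) : -1 <= x <= 1 -> 0 <= 1 - x ^+ 2.
Proof. by move=> hx; nra. Qed.

Lemma sqr_ge1 (R : realType) (x : R) : ~~ (-1 <= x <= 1) -> 1 - x ^+ 2 <= 0.
Proof. by rewrite negb_and -!ltNge => /orP[] hx; nra. Qed.

Lemma oval_middle (R : realType) (x : R) : -1 <= x <= 1 ->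
  [/\ ovalX x = x, ovalY x = 0, ovalX' x = 1 & ovalY' x = 0].
Proof.
by move=> hx; rewrite /ovalX /ovalX' /ovalY /ovalY'; ramps; split; ring.
Qed.

Lemma oval_12 (R : realType) (x : R) : 1 <= x <= 2 ->
  [/\ ovalX x = x - (x - 1) ^+ 2 / 2, ovalY x = (x - 1) ^+ 2,
      ovalX' x = 2 - x & ovalY' x = 2 * (x - 1)].
Proof.
by move=> hx; rewrite /ovalX /ovalX' /ovalY /ovalY'; ramps; split; field.
Qed.

Lemma oval_23 (R : realType) (x : R) : 2 <= x <= 3 ->
  [/\ ovalX x = x - (x - 1) ^+ 2 / 2, ovalY x = 2 - (3 - x) ^+ 2,
      ovalX' x = 2 - x & ovalY' x = 2 * (3 - x)].
Proof.
by move=> hx; rewrite /ovalX /ovalX' /ovalY /ovalY'; ramps; split; field.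
Qed.

Lemma oval_34 (R : realType) (x : R) : 3 <= x ->
  [/\ ovalX x = 4 - x, ovalY x = 2, ovalX' x = -1 & ovalY' x = 0].
Proof.
by move=> hx; rewrite /ovalX /ovalX' /ovalY /ovalY'; ramps; split; field.
Qed.

Lemma oval_sym (R : realType) (x : R) :
  [/\ ovalX (- x) = - ovalX x, ovalY (- x) = ovalY x,
      ovalX' (- x) = ovalX' x & ovalY' (- x) = - ovalY' x].
Proof.
rewrite /ovalX /ovalX' /ovalY /ovalY' opprK.
by split; ring.
Qed.

Lemma profile_outside (R : realType) b (x : R) : ~~ (-1 <= x <= 1) ->
  [/\ loopX b x = ovalX x, loopY b x = ovalY x,
      loopX' b x = ovalX' x & loopY' b x = ovalY' x].
Proof.
move=> /sqr_ge1 hx; rewrite /loopX /loopY /loopX' /loopY' /ramp2.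
by rewrite (ramp_neg hx); split; ring.
Qed.

Lemma profile_inside (R : realType) b (x : R) : -1 <= x <= 1 ->
  [/\ loopX b x = x * (1 - 2 * (b%:R * (1 - x ^+ 2) ^+ 2)),
      loopY b x = 2^-1 * (b%:R * (1 - x ^+ 2) ^+ 2),
      loopX' b x = 1 - b%:R * (2 * (1 - x ^+ 2) ^+ 2 - 8 * x ^+ 2 * (1 - x ^+ 2)) &
      loopY' b x = - b%:R * (2 * x * (1 - x ^+ 2))].
Proof.
move=> hx; have [eX eY eX' eY'] := oval_middle hx.
rewrite /loopX /loopY /loopX' /loopY' /ramp2 (ramp_pos (sqr_le1 hx)).
by rewrite eX eY eX' eY'; split; ring.
Qed.

Lemma oval_right (R : realType) (x : R) : 1 <= x <= 4 ->
  0 <= ovalX x /\ (ovalX x = 0 -> x = 4).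
Proof.
move=> hx; have [x2|x2] := leP x 2.
  have [|-> _ _ _] := @oval_12 R x; first by lra.
  by split; nra.
have [x3|x3] := leP x 3.
  have [|-> _ _ _] := @oval_23 R x; first by lra.
  by split; nra.
have [|-> _ _ _] := @oval_34 R x; first by lra.
by split; lra.
Qed.

(** On the right half the ordinate is strictly increasing up to 3, where the
    abscissa takes over and strictly decreases. *)
Lemma oval_right_inj (R : realType) (x y : R) : 1 <= x <= 4 -> 1 <= y <= 4 ->
  ovalX x = ovalX y -> ovalY x = ovalY y -> x = y.
Proof.
wlog xy : x y / x <= y => [W|].
  move=> hx hy eX eY; case: (leP x y) => xy; first exact: W.
  by apply/esym/W => //; exact: ltW.
move=> hx hy.
have [x2|x2] := leP x 2; [have [|-> -> _ _] := @oval_12 R x|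
  have [x3|x3] := leP x 3; [have [|-> -> _ _] := @oval_23 R x|
    have [|-> -> _ _] := @oval_34 R x]]; try lra;
(have [y2|y2] := leP y 2; [have [|-> -> _ _] := @oval_12 R y|
  have [y3|y3] := leP y 3; [have [|-> -> _ _] := @oval_23 R y|
    have [|-> -> _ _] := @oval_34 R y]]); try lra; nra.
Qed.

(** The round side lies beyond the box sideways and the flat top lies above it. *)
Lemma oval_far (R : realType) (x : R) : 1 < x <= 4 -> 1 < ovalX x \/ 1 < ovalY x.
Proof.
move=> hx; have [x2|x2] := leP x 2.
  have [|-> _ _ _] := @oval_12 R x; first by lra.
  by left; nra.
have [x3|x3] := ltP x 3.
  have [|-> _ _ _] := @oval_23 R x; first by lra.
  by left; nra.
have [|_ -> _ _] := @oval_34 R x; first by lra.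
by right; lra.
Qed.

(** The abscissa is stationary only at the middle of the side, [x = 2], where the
    ordinate has velocity 2. *)
Lemma oval_immersed (R : realType) (x : R) : 1 <= x ->
  ovalX' x = 0 -> ovalY' x = 0 -> False.
Proof.
move=> hx; have [x2|x2] := leP x 2.
  have [|_ _ -> ->] := @oval_12 R x; first by lra.
  by lra.
have [x3|x3] := ltP x 3.
  have [|_ _ -> ->] := @oval_23 R x; first by lra.
  by lra.
have [|_ _ -> ->] := @oval_34 R x; first by lra.
by lra.
Qed.

Lemma oval_seamless (R : realType) (x : R) : -5 < x < -3 ->
  [/\ ovalX (x + 8) = ovalX x, ovalY (x + 8) = ovalY x,
      ovalX' (x + 8) = ovalX' x & ovalY' (x + 8) = ovalY' x].
Proof.
move=> hx; have [|-> -> -> ->] := @oval_34 R (x + 8); first by lra.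
have [|eX eY eX' eY'] := @oval_34 R (- x); first by lra.
have [] := oval_sym (- x); rewrite opprK eX eY eX' eY' => -> -> -> ->.
by split; ring.
Qed.

Lemma profile_seamless (R : realType) b :
  [/\ seamless (@loopX R b), seamless (@loopY R b),
      seamless (@loopX' R b) & seamless (@loopY' R b)].
Proof.
have H (x : R) : -5 < x < -3 ->
    [/\ loopX b (x + 8) = loopX b x, loopY b (x + 8) = loopY b x,
        loopX' b (x + 8) = loopX' b x & loopY' b (x + 8) = loopY' b x].
  move=> hx; have [|-> -> -> ->] := @profile_outside R b (x + 8); first by lra.
  have [|-> -> -> ->] := @profile_outside R b x; first by lra.
  exact: oval_seamless.
by split=> x /H[].
Qed.

Lemma profile_inside_of_box (R : realType) b (x : R) : -4 <= x < 4 ->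
  -1 <= loopX b x <= 1 -> loopY b x <= 1 -> -1 <= x <= 1.
Proof.
move=> hx hX hY; apply: contraT => nx; move: hX hY.
have [-> -> _ _] := profile_outside b nx; move=> hX hY.
move: nx; rewrite negb_and -!ltNge => /orP[] nx.
  have [||] := @oval_far R (- x); first by lra.
    by have [-> _ _ _] := oval_sym x; lra.
  by have [_ -> _ _] := oval_sym x; lra.
by have [||] := @oval_far R x; lra.
Qed.

Lemma profile_box_of_inside (R : realType) b (x : R) : -1 <= x <= 1 ->
  -1 <= loopX b x <= 1 /\ loopY b x <= 1.
Proof.
move=> hx; have [-> -> _ _] := profile_inside b hx; have := sqr_1B_range hx.
move: ((1 - x ^+ 2) ^+ 2) => w hw.
have hb : 0 <= b%:R * w <= 1 by case: b; rewrite ?mul1r ?mul0r //; lra.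
split; last by lra.
have : `|x * (1 - 2 * (b%:R * w))| <= 1.
  by rewrite normrM mulr_ile1 // ler_norml; lra.
by rewrite ler_norml.
Qed.

(** The abscissa is positive on the right and nonpositive on the left, so the two
    sides do not meet, and each is embedded. *)
Lemma oval_outside_inj (R : realType) (x y : R) : -4 <= x < 4 -> -4 <= y < 4 ->
  ~~ (-1 <= x <= 1) -> ~~ (-1 <= y <= 1) ->
  ovalX x = ovalX y -> ovalY x = ovalY y -> x = y.
Proof.
move=> hx hy; rewrite !negb_and -!ltNge => nx ny eX eY.
have [sx sx' _ _] := oval_sym x; have [sy sy' _ _] := oval_sym y.
case/orP: nx => nx; case/orP: ny => ny.
- by apply/oppr_inj/oval_right_inj; rewrite ?sx ?sy ?sx' ?sy' ?eX ?eY //; lra.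
- have [|hX _] := @oval_right R (- x); first by lra.
  have [|hY y4] := @oval_right R y; first by lra.
  by have := y4 _; lra.
- have [|hX x4] := @oval_right R x; first by lra.
  have [|hY _] := @oval_right R (- y); first by lra.
  by have := x4 _; lra.
- by apply: oval_right_inj => //; lra.
Qed.

(** The bottom stays in the box and the rest of the oval avoids it, so a double
    point lies on one of them; the rest is embedded, and the bottom is the curl
    or a segment. *)
Lemma profile_double (R : realType) b (x y : R) : -4 <= x < 4 -> -4 <= y < 4 ->
  x <> y -> loopX b x = loopX b y -> loopY b x = loopY b y ->
  [/\ b, -1 <= x <= 1, y = - x & (1 - x ^+ 2) ^+ 2 = 2^-1].
Proof.
move=> hx hy nxy eX eY.
have xy : (-1 <= x <= 1) = (-1 <= y <= 1).
  apply/idP/idP => h; have [hX hY] := profile_box_of_inside b h.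
    by apply: (@profile_inside_of_box R b) => //; rewrite -?eX -?eY.
  by apply: (@profile_inside_of_box R b) => //; rewrite ?eX ?eY.
case: (boolP (-1 <= x <= 1)) => ix; have iy := ix; rewrite xy in iy.
  move: eX eY; have [-> -> _ _] := profile_inside b ix.
  have [-> -> _ _] := profile_inside b iy; case: b; rewrite ?mul1r ?mul0r.
    move=> eX eY; have {}eY : (1 - x ^+ 2) ^+ 2 = (1 - y ^+ 2) ^+ 2 by lra.
    by have [] := curl_double ix iy nxy eX eY.
  by move=> eX; case: nxy; lra.
case: nxy; apply: oval_outside_inj => //.
  have [<- _ _ _] := profile_outside b ix.
  by have [<- _ _ _] := profile_outside b iy.
have [_ <- _ _] := profile_outside b ix.
by have [_ <- _ _] := profile_outside b iy.
Qed.

Lemma profile_immersed (R : realType) b (x : R) :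
  loopX' b x = 0 -> loopY' b x = 0 -> False.
Proof.
case: (boolP (-1 <= x <= 1)) => ix.
  have [_ _ -> ->] := profile_inside b ix.
  case: b; rewrite ?mul1r ?mul0r; last by lra.
  move=> eX /eqP; rewrite mulNr mul1r oppr_eq0 !mulf_eq0 pnatr_eq0 /=.
  by case/orP=> /eqP x0; move: eX; rewrite x0; lra.
have [_ _ -> ->] := profile_outside b ix.
move: ix; rewrite negb_and -!ltNge => /orP[] nx.
  have [_ _ <- sy] := oval_sym x; move=> eX eY.
  by apply: (@oval_immersed R (- x)) => //; [lra | rewrite sy eY oppr0].
by apply: oval_immersed; lra.
Qed.

(** With [w = 1 - x^2] and [w^2 = 1/2], the determinant at the crossing is
    [4 x w (8 w - 4)]. *)
Lemma profile_transverse (R : realType) (x : R) : -1 <= x <= 1 -> x != 0 ->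
  (1 - x ^+ 2) ^+ 2 = 2^-1 ->
  loopX' true x * loopY' true (- x) - loopY' true x * loopX' true (- x) != 0.
Proof.
move=> hx x0; have hNx : -1 <= - x <= 1 by lra.
have [_ _ -> ->] := profile_inside true hx.
have [_ _ -> ->] := profile_inside true hNx.
rewrite sqrrN !mulNr !mul1r; have x2 : x ^+ 2 = 1 - (1 - x ^+ 2) by ring.
move: (1 - x ^+ 2) x2 => w -> ew.
set v := (X in X != 0); have -> : v = 4 * x * w * (8 * w - 4).
  rewrite /v ew; have e2 : w * w = 2^-1 by rewrite -expr2.
  transitivity (4 * x * w * (8 * w - 8 * (w * w) + 1 - 2 * 2^-1)); first by field.
  by rewrite e2; field.
rewrite !mulf_neq0 ?pnatr_eq0 //; apply/eqP => e0.
  by move: ew; rewrite e0; lra.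
by have e : w = 2^-1; [lra | move: ew; rewrite e; lra].
Qed.

(** * A virtual move I between two diagrams *)

Definition loop (R : realType) (b : bool) (s : R) : R * R :=
  (loopX b (chart s), loopY b (chart s)).

Lemma loop_C1 (R : realType) b : C1 (@loop R b) /\
  forall s : R, derive1 (loop b) s =
    (loopX' b (chart s) * 8, loopY' b (chart s) * 8).
Proof.
have [sX sY sX' sY'] := @profile_seamless R b.
apply: (@C1_pair R (fun s => loopX b (chart s)) (fun s => loopY b (chart s))
  (fun s => loopX' b (chart s) * 8) (fun s => loopY' b (chart s) * 8)).
- move=> s; exact: (is_derive_chart sX (is_derive_loopX b (chart s))).
- move=> s; exact: (is_derive_chart sY (is_derive_loopY b (chart s))).
- move=> s; apply: cvgM; last exact: cvg_cst.
  exact: (continuous_chart sX' (@continuous_loopX' R b)).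
- move=> s; apply: cvgM; last exact: cvg_cst.
  exact: (continuous_chart sY' (@continuous_loopY' R b)).
Qed.

Lemma loop_double (R : realType) b (s t : R) : double_pair (loop b) s t ->
  [/\ b, -1 <= chart s <= 1, chart s != 0, chart t = - chart s &
      (1 - chart s ^+ 2) ^+ 2 = 2^-1].
Proof.
case=> -[eX eY] nst; have nx : chart s <> chart t by move/same_param_chart.
have [hb hs ts e] := profile_double (chart_range s) (chart_range t) nx eX eY.
by split=> //; apply/eqP => s0; apply: nx; rewrite ts s0 oppr0.
Qed.

Lemma loop_generic (R : realType) b : generic_immersion (@loop R b).
Proof.
have [lC1 lD] := @loop_C1 R b; split=> //.
- move=> s; rewrite /loop (_ : chart (s + 1) = chart s) //.
  by apply/same_param_chart; exact: (same_param_natr 1).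
- move=> s; rewrite lD => -[/eqP + /eqP].
  rewrite !mulf_eq0 !pnatr_eq0 !orbF => /eqP eX /eqP eY.
  exact: profile_immersed eX eY.
- move=> s t /loop_double[hb hs s0 ts e]; rewrite /det2 !lD /= ts hb.
  set x := chart s in hs s0 e *; have := profile_transverse hs s0 e.
  set v := (X in X != 0) => v0; set w := (X in X <> 0).
  have -> : w = 64 * v by rewrite /w /v; ring.
  by apply/eqP; rewrite mulf_neq0 ?pnatr_eq0.
- move=> s t u /loop_double[_ _ _ ts _] /loop_double[_ _ _ ut _].
  by apply/same_param_chart; rewrite ut ts opprK.
- apply: (@sub_finite_set _ _ [set (0, 2^-1 * 2^-1)]); last exact: finite_set1.
  move=> _ [s [t [/loop_double[hb hs _ _ e] <-]]] /=; rewrite /loop.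
  have [-> -> _ _] := profile_inside b hs; rewrite hb mul1r e.
  by congr (_, _); field.
Qed.

(** Marking every pair of parameters virtual is harmless: marks count only at
    crossings, and the diagrams have at most the one crossing of the curl. *)
Definition loop_diagram (R : realType) (b : bool) : diagram R :=
  @Diagram R (loop b) (fun _ _ => Virtual) (loop_generic R b)
    (fun _ _ _ => erefl) (fun _ _ _ => erefl).

Definition loop_tangle (R : realType) (b : bool) : tangle R 1 :=
  if b then tangle1_curl R Virtual else tangle1_flat R.

Lemma chart_strand (R : realType) (s : R) :
  strand_param (fun _ : 'I_1 => 2^-1) (fun=> 8^-1) s <-> -1 <= chart s <= 1.
Proof.
split.
  case=> i [t [ht /same_param_chart ->]]; rewrite -[_ + _]addr0.
  by rewrite (@chartE R 0) //; lra.
move=> hs; exists ord0, (chart s); split=> //; apply/same_param_chart.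
by rewrite -[X in _ = chart X]addr0 (@chartE R 0) //; lra.
Qed.

Lemma loop_contains (R : realType) b :
  contains (stretch 2^-1) (fun=> 2^-1) (fun=> 8^-1) (loop_tangle R b)
    (loop_diagram R b).
Proof.
split.
- move=> i t ht; rewrite /= /loop -[X in chart X]addr0 (@chartE R 0); last by lra.
  have [-> -> _ _] := profile_inside b ht.
  by case: b => /=; rewrite /stretch /= ?curl_abscissa; congr (_, _); ring.
- move=> s [[u v] hb [eX eY]]; apply/chart_strand.
  move: hb; rewrite /box /= => /andP[hu hv].
  by apply: (@profile_inside_of_box R b); rewrite ?chart_range // -?eX -?eY /=; lra.
- by move=> i j s t hs ht _; case: b => //=; case: ifP.
Qed.

Lemma loop_move1 (R : realType) :
  move1 Virtual (loop_diagram R false) (loop_diagram R true).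
Proof.
exists (stretch 2^-1), (fun=> 2^-1), (fun=> 8^-1); split.
- split; first by apply: diffeo_stretch; rewrite invr_eq0 pnatr_eq0.
  split=> [i|i j s t hs ht /same_param_chart].
    by rewrite invr_eq0 pnatr_eq0.
  rewrite -[X in chart X]addr0 -[X in _ = chart X]addr0 !(@chartE R 0); try lra.
  by rewrite (ord1 i) (ord1 j).
- exact: loop_contains R false.
- exact: loop_contains R true.
- move=> s ns; have {}ns : ~~ (-1 <= chart s <= 1).
    by apply/negP => /chart_strand.
  rewrite /= /loop; have [-> -> _ _] := profile_outside false ns.
  by have [-> -> _ _] := profile_outside true ns.
- by [].
Qed.

Theorem claim8p47 (R : realType) :
  exists D D' : diagram R,
    welded_equivalent D D' /\ ~ rotational_welded_equivalent D D'.
Proof.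
exists (loop_diagram R false), (loop_diagram R true); split.
  by apply: rst_step; apply: step_virtual1; exact: loop_move1.
by move/rotational_welded_parity; exact: (move1_virtual_parity (loop_move1 R)).
Qed.
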